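(* Let $G$ be a graph of order $n$ with minimum degree $\delta$. If $\delta>0$ and $n<\delta^2/(\ln\delta+1)$, then $$ \gamma_r(G)\le\frac{\ln(\delta+1)+1}{\delta+1}\,n \qquad\text{and}\qquad \gamma_{\mathrm{tr}}(G)\le\frac{\ln\delta+1}{\delta}\,n . $$
   Context: All graphs are finite and undirected, without loops or multiple edges. A set $X\subseteq V(G)$ is a dominating set of $G$ if every vertex not in $X$ is adjacent to a vertex in $X$. A dominating set $X$ is a restrained dominating set if every vertex in $V(G)-X$ is adjacent to a vertex in $V(G)-X$; $\gamma_r(G)$ is the minimum cardinality of a restrained dominating set. A restrained dominating set $X$ is a total restrained dominating set if, in addition, every vertex of $X$ is adjacent to a vertex of $X$; $\gamma_{\mathrm{tr}}(G)$ is the minimum cardinality of a total restrained dominating set. *)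

(* Defs.v *)
From mathcomp Require Import all_boot all_order all_algebra.
From mathcomp Require Import reals exp.

Set Implicit Arguments.
Unset Strict Implicit.
Unset Printing Implicit Defensive.

(* A finite simple graph is a symmetric irreflexive relation [e] on a finite
   type [T] of vertices. *)
Definition simple_graph (T : finType) (e : rel T) : Prop :=
  symmetric e /\ irreflexive e.

Definition degree (T : finType) (e : rel T) (v : T) : nat :=
  #|[set u | e v u]|.

(* Degrees never exceed #|T|, so the default value #|T| of the iterated
   minimum is only visible on the empty graph, where it is 0. *)
Definition min_degree (T : finType) (e : rel T) : nat :=
  \big[minn/#|T|]_(v : T) degree e v.

Lemma min_degree_le (T : finType) (e : rel T) (v : T) :
  min_degree e <= degree e v.
Proof.
rewrite /min_degree; have := mem_index_enum v.
elim: (index_enum T) => // w r IHr; rewrite inE big_cons => /orP[/eqP <-|vr].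
  exact: geq_minl.
by rewrite geq_min IHr // orbT.
Qed.

Definition dominating (T : finType) (e : rel T) (X : {set T}) : bool :=
  [forall v in ~: X, [exists u in X, e v u]].

Definition restrained_dominating (T : finType) (e : rel T) (X : {set T})
    : bool :=
  dominating e X && [forall v in ~: X, [exists u in ~: X, e v u]].

Definition total_restrained_dominating (T : finType) (e : rel T) (X : {set T})
    : bool :=
  restrained_dominating e X && [forall v in X, [exists u in X, e v u]].

Lemma restrained_dominating_setT (T : finType) (e : rel T) :
  restrained_dominating e [set: T].
Proof.
by apply/andP; split; apply/forall_inP => v; rewrite setCT inE.
Qed.

Lemma total_restrained_dominating_setT (T : finType) (e : rel T) :
  0 < min_degree e -> total_restrained_dominating e [set: T].
Proof.
move=> d0; rewrite /total_restrained_dominating restrained_dominating_setT /=.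
apply/forall_inP => v _; have : 0 < degree e v.
  apply: leq_trans d0 _.
  exact: min_degree_le.
by case/card_gt0P => u; rewrite inE => evu; apply/existsP; exists u; rewrite inE.
Qed.

(* The full vertex set is the required initial candidate of [arg min]. *)
Definition gamma_r (T : finType) (e : rel T) : nat :=
  #|[arg min_(X < [set: T] | restrained_dominating e X) #|X| ]|.

(* Meaningful only for graphs without isolated vertices, which are exactly the
   graphs having a total restrained dominating set. *)
Definition gamma_tr (T : finType) (e : rel T) : nat :=
  #|[arg min_(X < [set: T] | total_restrained_dominating e X) #|X| ]|.

Lemma gamma_rP (T : finType) (e : rel T) :
  (exists2 X : {set T}, restrained_dominating e X & #|X| = gamma_r e) /\
  (forall X : {set T}, restrained_dominating e X -> gamma_r e <= #|X|).
Proof.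
rewrite /gamma_r; case: arg_minnP => [|X PX minX].
  exact: restrained_dominating_setT.
by split => //; exists X.
Qed.

Lemma gamma_trP (T : finType) (e : rel T) : 0 < min_degree e ->
  (exists2 X : {set T}, total_restrained_dominating e X & #|X| = gamma_tr e) /\
  (forall X : {set T}, total_restrained_dominating e X -> gamma_tr e <= #|X|).
Proof.
move=> d0; rewrite /gamma_tr; case: arg_minnP => [|X PX minX].
  exact: total_restrained_dominating_setT.
by split => //; exists X.
Qed.

(* Main.v *)
(* If every [S v] has at least [k] elements, a random set containing each
   vertex independently with probability [ln k / k] misses a given [S v] with
   probability at most [1 / k], so adding one point of each missed set gives a
   transversal of size at most [(ln k + 1) / k * n]. Closed and open
   neighbourhoods yield a dominating and a total dominating set. The bound on
   [n] makes both smaller than [delta], so they contain no full neighbourhood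
   and are automatically restrained. *)
Require Import Defs.
From mathcomp Require Import all_boot all_order all_algebra.
From mathcomp Require Import reals exp.
From mathcomp Require Import sequences ring lra.
Import Order.TTheory GRing.Theory Num.Theory.
Local Open Scope ring_scope.

(* Method of conditional expectations: the right-hand side is the expectation
   of the left-hand side when [X] is [A] together with a random subset of [s],
   and one of the two choices for the head of [s] does not increase it. *)
Lemma small_set_few_missed (R : realType) (T : finType) (S : T -> {set T})
    (p : R) (s : seq T) (A : {set T}) :
  0 <= p <= 1 ->
  exists X : {set T},
    #|X|%:R + \sum_v ([disjoint S v & X])%:R <=
    #|A|%:R + p * (size s)%:R +
      \sum_v ([disjoint S v & A])%:R * (1 - p) ^+ count [in S v] s.
Proof.
move=> /andP[p0 p1]; elim: s A => [|a s IHs] A.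
  exists A; rewrite /= mulr0 addr0 lerD2l.
  by apply: ler_sum => v _; rewrite expr0 mulr1.
set rhs := (X in exists _, _ <= X).
set f := fun B : {set T} => #|B|%:R + p * (size s)%:R +
   \sum_v ([disjoint S v & B])%:R * (1 - p) ^+ count [in S v] s.
have step : p * f (a |: A) + (1 - p) * f A <= rhs.
  have cardU : #|a |: A|%:R <= #|A|%:R + 1 :> R.
    by rewrite -[1]/(1%:R) -natrD ler_nat cardsU1 addnC leq_add2l leq_b1.
  have sumE : p * (\sum_v ([disjoint S v & a |: A])%:R
                     * (1 - p) ^+ count [in S v] s) +
      (1 - p) * (\sum_v ([disjoint S v & A])%:R * (1 - p) ^+ count [in S v] s) =
      \sum_v ([disjoint S v & A])%:R * (1 - p) ^+ count [in S v] (a :: s).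
    rewrite !mulr_sumr -big_split /=; apply: eq_bigr => v _.
    have -> : [disjoint S v & a |: A] =
        (a \notin S v) && [disjoint S v & A].
      rewrite ![[disjoint S v & _]]disjoint_sym !disjoints_subset.
      by rewrite subUset sub1set inE.
    rewrite /=.
    (* If [a \in S v], only the branch without [a] leaves [S v] missed, and its weight is the extra
       factor [1 - p]; otherwise the two weights add up to 1. *)
    by case: (a \in S v) => /=; rewrite ?add1n ?add0n ?exprS; ring.
  rewrite /rhs /f -sumE /= -natr1.
  have := ler_wpM2l p0 cardU; lra.
have [le_f|lt_f] := lerP (f A) rhs.
  by have [X leX] := IHs A; exists X; apply: le_trans leX le_f.
have [X leX] := IHs (a |: A); exists X; apply: le_trans leX _.
(* Since [f A] exceeds [rhs], the average in [step] forces [f (a |: A) <= rhs] after division by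
   [p]. For [p = 0], [step] reads [f A <= rhs], a contradiction. *)
rewrite -/(f _); have [p_eq0|p_neq0] := eqVneq p 0.
  by move: step; rewrite p_eq0; lra.
have {p_neq0} p_gt0 : 0 < p by rewrite lt0r p_neq0.
rewrite -(ler_pM2l p_gt0).
have : (1 - p) * rhs <= (1 - p) * f A by rewrite ler_wpM2l ?subr_ge0 // ltW.
move: step; lra.
Qed.

Lemma small_transversal (R : realType) (T : finType) (S : T -> {set T})
    (k : nat) :
  (0 < k)%N -> (forall v, k <= #|S v|)%N ->
  exists2 X : {set T}, forall v, exists2 u, u \in X & u \in S v &
    #|X|%:R <= (ln k%:R + 1) / k%:R * #|T|%:R :> R.
Proof.
move=> k_gt0 leS.
have kR : 0 < k%:R :> R by rewrite ltr0n.
have k1 : 1 <= k%:R :> R by rewrite ler1n.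
pose p : R := ln k%:R / k%:R.
have p0 : 0 <= p by rewrite divr_ge0 ?ln_ge0 // ltW.
have p1 : p <= 1.
  rewrite ler_pdivrMr // mul1r.
  by apply: ltW; apply: ln_sublinear.
have [|X leX] := @small_set_few_missed R T S p (enum T) set0.
  by rewrite p0.
have S_neq0 v : exists u, u \in S v.
  by apply/card_gt0P; apply: leq_trans (leS v).
pose miss := [set v | [disjoint S v & X]].
exists (X :|: [set xchoose (S_neq0 v) | v in miss]).
  move=> v; have [vX|] := boolP [disjoint S v & X].
    exists (xchoose (S_neq0 v)); last exact: xchooseP.
    by rewrite inE; apply/orP; right; apply: imset_f; rewrite inE.
  rewrite disjoint_sym => /pred0Pn[u /andP[/= uX uS]].
  by exists u => //; rewrite inE uX.
have le_card : #|X :|: [set xchoose (S_neq0 v) | v in miss]|%:R <=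
    #|X|%:R + #|miss|%:R :> R.
  rewrite -natrD ler_nat; apply: leq_trans (leq_card_setU _ _) _.
  by rewrite leq_add2l leq_imset_card.
apply: le_trans le_card _.
have -> : #|miss|%:R = \sum_v ([disjoint S v & X])%:R :> R.
  rewrite -sum1_card natr_sum big_mkcond /=; apply: eq_bigr => v _.
  by rewrite inE; case: ifP.
apply: le_trans leX _; rewrite cards0 add0r -cardT.
have -> : (ln k%:R + 1) / k%:R * #|T|%:R =
    p * #|T|%:R + \sum_(v : T) k%:R^-1 :> R.
  by rewrite sumr_const -[_^-1 *+ _]mulr_natr /p; ring.
rewrite lerD2l; apply: ler_sum => v _.
have -> : [disjoint S v & (set0 : {set T})].
  by rewrite -setI_eq0 setI0.
rewrite mul1r.
have -> : count [in S v] (enum T) = #|S v|.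
  by rewrite enumT cardE size_filter.
have q0 : 0 <= 1 - p by rewrite subr_ge0.
(* Each missed-set term is at most [(1 - p)^k <= exp(-p k) = exp(-ln k) = 1 / k]. *)
apply: (@le_trans _ _ ((1 - p) ^+ k)).
  by apply: ler_wiXn2l; rewrite ?leS // gerBl.
apply: (@le_trans _ _ (expR (- p) ^+ k)).
  by rewrite lerXn2r ?nnegrE ?expR_ge0 // expR_ge1Dx.
by rewrite -expRM_natr mulNr /p divfK ?gt_eqF // expRN lnK ?posrE.
Qed.

(** Follows from [ln (x + 1) <= ln x + 1 / x] once denominators are cleared. It lets the bound on
    [n], stated for [delta], also serve closed neighbourhoods, of size at least [delta + 1]. *)
Lemma ln_add1_div_decreasing (R : realType) (x : R) : 1 <= x ->
  (ln (x + 1) + 1) / (x + 1) <= (ln x + 1) / x.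
Proof.
move=> x1; have x0 : 0 < x by lra.
have lnx : 0 <= ln x by exact: ln_ge0.
rewrite ler_pdivrMr; last lra.
rewrite mulrAC ler_pdivlMr //.
have lnS : ln (x + 1) <= ln x + x^-1.
  have -> : x + 1 = x * (1 + x^-1) by field; lra.
  rewrite lnM ?posrE ?addr_gt0 ?invr_gt0 // lerD2l.
  by apply: le_ln1Dx; rewrite (lt_trans (ltrN10 _)) ?invr_gt0.
have := ler_wpM2r (ltW x0) lnS.
rewrite [(_ + x^-1) * x]mulrDl mulVf ?gt_eqF //; lra.
Qed.

(** A set this small cannot contain all neighbours of any vertex, so each vertex has a neighbour
    outside [X]. *)
Lemma small_dominating_restrained (T : finType) (e : rel T) (X : {set T}) :
  dominating e X -> (#|X| < min_degree e)%N -> restrained_dominating e X.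
Proof.
move=> domX ltX; rewrite /restrained_dominating domX.
apply/forall_inP => v _.
have : ~~ ([set u | e v u] \subset X).
  apply: contraTN ltX => /subset_leq_card leX; rewrite -leqNgt.
  exact: leq_trans (min_degree_le e v) leX.
case/subsetPn => u; rewrite inE => evu uX.
by apply/exists_inP; exists u => //; rewrite inE.
Qed.

Theorem proposition1 (R : realType) (T : finType) (e : rel T) (n delta : nat)
    (He : simple_graph e)
    (Hn : #|T| = n)
    (Hdelta : min_degree e = delta)
    (Hpos : (0 < delta)%N)
    (Hlt : n%:R < delta%:R ^+ 2 / (ln delta%:R + 1) :> R) :
  (gamma_r e)%:R <= (ln (delta%:R + 1) + 1) / (delta%:R + 1) * n%:R :> R
  /\ (gamma_tr e)%:R <= (ln delta%:R + 1) / delta%:R * n%:R :> R.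
Proof.
have [_ irr_e] := He.
have d1 : 1 <= delta%:R :> R by rewrite ler1n.
have d0 : 0 < delta%:R :> R by rewrite ltr0n.
have lnd : 0 <= ln delta%:R :> R by exact: ln_ge0.
(* This is [Hlt] multiplied by [(ln delta + 1) / delta]. *)
have bound_tr : (ln delta%:R + 1) / delta%:R * n%:R < delta%:R :> R.
  rewrite mulrAC ltr_pdivrMr // -expr2 mulrC -ltr_pdivlMr //; lra.
have bound_r : (ln (delta%:R + 1) + 1) / (delta%:R + 1) * n%:R < delta%:R :> R.
  apply: le_lt_trans bound_tr.
  by rewrite ler_wpM2r // ln_add1_div_decreasing.
have deg v : (delta <= #|[set u | e v u]|)%N.
  by rewrite -Hdelta; apply: min_degree_le.
split.
- have degS v : (delta.+1 <= #|v |: [set u | e v u]|)%N.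
    by rewrite cardsU1 inE irr_e add1n ltnS.
  have [X hitX leX] := small_transversal R T _ delta.+1 isT degS.
  rewrite -natr1 Hn in leX; apply: le_trans (leX); rewrite ler_nat.
  apply: (gamma_rP e).2; apply: small_dominating_restrained.
    apply/forall_inP => v; rewrite inE => vX.
    (* The point hitting the closed neighbourhood of [v] is not [v] itself, as [v] lies outside
       [X]. *)
    have [u uX] := hitX v; rewrite !inE => /predU1P[uv|evu].
      by rewrite -uv uX in vX.
    by apply/exists_inP; exists u.
  by rewrite Hdelta -(ltr_nat R); apply: le_lt_trans leX bound_r.
- have [X hitX leX] := small_transversal R T _ delta Hpos deg.
  rewrite Hn in leX; apply: le_trans (leX); rewrite ler_nat.
  (* Open neighbourhoods give every vertex, inside [X] or not, a neighbour in [X]: this yields both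
     domination and totality. *)
  have nbrX v : [exists u in X, e v u].
    by have [u uX] := hitX v; rewrite inE => evu; apply/exists_inP; exists u.
  have [|_ ->//] := gamma_trP (e := e); first by rewrite Hdelta.
  apply/andP; split; last by apply/forall_inP => v _.
  apply: small_dominating_restrained; first by apply/forall_inP => v _.
  by rewrite Hdelta -(ltr_nat R); apply: le_lt_trans leX bound_tr.
Qed.
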